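(* The following rules of contraction are admissible in $\mathrm{G3S5}^{;}$, where $A$ is an arbitrary formula, $p$ and $q$ are atomic formulas, $\Gamma,\Delta$ are multisets of formulas, $P,Q$ are multisets of atomic formulas, and both displayed occurrences of $p$ in the premise of $\mathrm{LC}^{;}$, as well as both displayed occurrences of $q$ in the premise of $\mathrm{RC}^{;}$, lie in the same block (i.e. have the same corresponding formula); for $\mathrm{LC}^{;}$ and $\mathrm{RC}^{;}$ the bound $n$ on the height of derivation is preserved: $$\mathrm{LC}^{;}:\ \dfrac{\Gamma;p,p,P\vdash_n Q;\Delta}{\Gamma;p,P\vdash_n Q;\Delta}\qquad \mathrm{RC}^{;}:\ \dfrac{\Gamma;P\vdash_n Q,q,q;\Delta}{\Gamma;P\vdash_n Q,q;\Delta}$$ $$\mathrm{LC}:\ \dfrac{A,A,\Gamma;P\vdash Q;\Delta}{A,\Gamma;P\vdash Q;\Delta}\qquad \mathrm{RC}:\ \dfrac{\Gamma;P\vdash Q;\Delta,A,A}{\Gamma;P\vdash Q;\Delta,A}$$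
   Context: Formulas: $A::=\bot\mid\top\mid p\mid\neg A\mid A\wedge A\mid A\vee A\mid A\to A\mid\Diamond A\mid\Box A$ ($p$ a propositional variable); $\top$ is read as an abbreviation of $\neg\bot$. Atomic formulas are the variables and $\bot$; modal formulas are those of the form $\Diamond A$ or $\Box A$. Multisets are finite; a comma denotes multiset union; $\neg\Gamma=\{\neg A:A\in\Gamma\}$. $\bigwedge X$, $\bigvee X$ are the conjunction and disjunction of the members of the multiset $X$ (in a fixed order; just the member if $X$ is a singleton). Semicolon sequents. A sequent $\Gamma;P\vdash Q;\Delta$ consists of multisets of formulas $\Gamma,\Delta$, multisets $P,Q$ of atomic formulas (the middle part), and a partition of the occurrences in $P$ and $Q$ into nonempty blocks, each marked as a $\Diamond$-block or a $\Box$-block. A block consisting of $P_0$ from $P$ and $Q_0$ from $Q$ has corresponding formula $\Diamond\bigwedge(P_0,\neg Q_0)$ if it is a $\Diamond$-block and $\Box\bigvee(\neg P_0,Q_0)$ if it is a $\Box$-block. The sequent stands for the ordinary sequent obtained by adding the corresponding formulas of all $\Diamond$-blocks to the antecedent $\Gamma$ and those of all $\Box$-blocks to the succedent $\Delta$. Semicolons next to an empty middle part are omitted; ordinary sequents $\Gamma\vdash\Delta$ have empty middle part. The system $\mathrm{G3S5}^{;}$ ($M,N$ multisets of modal formulas; $P,Q,P_i,Q_i$ multisets of atomic formulas; $\Gamma,\Delta$ arbitrary; premises before $\Rightarrow$, conclusion after). Axioms: $p,\Gamma;P\vdash Q;\Delta,p$ ($p$ atomic) and $\bot,\Gamma;P\vdash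 Q;\Delta$. L$\neg$: $\Gamma;P\vdash Q;\Delta,A\ \Rightarrow\ \neg A,\Gamma;P\vdash Q;\Delta$. R$\neg$: $A,\Gamma;P\vdash Q;\Delta\ \Rightarrow\ \Gamma;P\vdash Q;\Delta,\neg A$. L$\vee$: $A,\Gamma;P\vdash Q;\Delta$ and $B,\Gamma;P\vdash Q;\Delta\ \Rightarrow\ A\vee B,\Gamma;P\vdash Q;\Delta$. R$\vee$: $\Gamma;P\vdash Q;\Delta,A,B\ \Rightarrow\ \Gamma;P\vdash Q;\Delta,A\vee B$. L$\wedge$: $A,B,\Gamma;P\vdash Q;\Delta\ \Rightarrow\ A\wedge B,\Gamma;P\vdash Q;\Delta$. R$\wedge$: $\Gamma;P\vdash Q;\Delta,A$ and $\Gamma;P\vdash Q;\Delta,B\ \Rightarrow\ \Gamma;P\vdash Q;\Delta,A\wedge B$. L$\to$: $\Gamma;P\vdash Q;\Delta,A$ and $B,\Gamma;P\vdash Q;\Delta\ \Rightarrow\ A\to B,\Gamma;P\vdash Q;\Delta$. R$\to$: $A,\Gamma;P\vdash Q;\Delta,B\ \Rightarrow\ \Gamma;P\vdash Q;\Delta,A\to B$. R$\Diamond$: $\Gamma;P\vdash Q;\Delta,\Diamond A,A\ \Rightarrow\ \Gamma;P\vdash Q;\Delta,\Diamond A$. L$\Box$: $A,\Box A,\Gamma;P\vdash Q;\Delta\ \Rightarrow\ \Box A,\Gamma;P\vdash Q;\Delta$. L$\Diamond$: $A,M;P_1,P_2\vdash Q_2,Q_1;N\ \Rightarrow\ \Diamond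 A,M,P_1;P_2\vdash Q_2;Q_1,N$. R$\Box$: $M;P_1,P_2\vdash Q_2,Q_1;N,A\ \Rightarrow\ M,P_1;P_2\vdash Q_2;Q_1,N,\Box A$. L$\Diamond^{;}$ and R$\Box^{;}$ (same shape): $M,P_2;P_1,P_3\vdash Q_3,Q_1;Q_2,N\ \Rightarrow\ M,P_1;P_2,P_3\vdash Q_3,Q_2;Q_1,N$. In the rules other than L$\Diamond$, R$\Box$, L$\Diamond^{;}$, R$\Box^{;}$ the marked partition is the same in premises and conclusion. In L$\Diamond$ (resp. R$\Box$) the premise has the blocks of the conclusion together with the new block formed by $P_1,Q_1$, marked $\Box$ (resp. $\Diamond$); no block is added if $P_1,Q_1$ are both empty. In L$\Diamond^{;}$ (resp. R$\Box^{;}$) $P_2,Q_2$ form one $\Diamond$-block (resp. $\Box$-block) of the conclusion; in the premise this block is removed, $P_1,Q_1$ form a new $\Box$-block (resp. $\Diamond$-block; none if empty), and the blocks of $P_3,Q_3$ are unchanged. $\vdash_n$ means that the sequent has a derivation of height at most $n$ (height = maximal number of rule applications on a branch; axioms have height $0$). A rule is admissible if, for each of its instances, provability of all premises in $\mathrm{G3S5}^{;}$ implies provability of the conclusion. In the contraction rules the marked partition of the conclusion is that of the premise, with one of the two contracted occurrences deleted in the case of $\mathrm{LC}^{;}$, $\mathrm{RC}^{;}$. *)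

(* Defs.v *)
From HB Require Import structures.
From mathcomp Require Import all_boot.
From mathcomp Require Import finmap multiset.

Set Implicit Arguments.
Unset Strict Implicit.
Unset Printing Implicit Defensive.

Local Open Scope mset_scope.

Inductive form : Type :=
| Bot
| Var of nat
| Neg of form
| And of form & form
| Or of form & form
| Imp of form & form
| Dia of form
| Box of form.

Definition Top : form := Neg Bot.

Definition atomic (A : form) : bool :=
  match A with Bot | Var _ => true | _ => false end.

Definition modal (A : form) : bool :=
  match A with Dia _ | Box _ => true | _ => false end.

(* Multisets need a choiceType of elements, hence the encoding into trees. *)
Fixpoint form_encode (A : form) : GenTree.tree nat :=
  match A with
  | Bot => GenTree.Node 0 [::]
  | Var n => GenTree.Leaf n
  | Neg A => GenTree.Node 1 [:: form_encode A]
  | And A B => GenTree.Node 2 [:: form_encode A; form_encode B]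
  | Or A B => GenTree.Node 3 [:: form_encode A; form_encode B]
  | Imp A B => GenTree.Node 4 [:: form_encode A; form_encode B]
  | Dia A => GenTree.Node 5 [:: form_encode A]
  | Box A => GenTree.Node 6 [:: form_encode A]
  end.

Fixpoint form_decode (t : GenTree.tree nat) : form :=
  match t with
  | GenTree.Leaf n => Var n
  | GenTree.Node 1 [:: a] => Neg (form_decode a)
  | GenTree.Node 2 [:: a; b] => And (form_decode a) (form_decode b)
  | GenTree.Node 3 [:: a; b] => Or (form_decode a) (form_decode b)
  | GenTree.Node 4 [:: a; b] => Imp (form_decode a) (form_decode b)
  | GenTree.Node 5 [:: a] => Dia (form_decode a)
  | GenTree.Node 6 [:: a] => Box (form_decode a)
  | _ => Bot
  end.

Lemma form_encodeK : cancel form_encode form_decode.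
Proof. by elim=> //= [A -> | A -> B -> | A -> B -> | A -> B -> | A -> | A ->]. Qed.

HB.instance Definition _ := Choice.copy form (can_type form_encodeK).

Inductive mark : Type := DiaMark | BoxMark.

Definition mark_to_bool (m : mark) : bool := if m is DiaMark then true else false.
Definition bool_to_mark (b : bool) : mark := if b then DiaMark else BoxMark.

Lemma mark_to_boolK : cancel mark_to_bool bool_to_mark.
Proof. by case. Qed.

HB.instance Definition _ := Choice.copy mark (can_type mark_to_boolK).

(* A block (m, P, Q): P and Q are the parts of the block lying to the left and
   to the right of the turnstile.  Its corresponding formula is
   Dia (/\ (P, ~Q)), in the antecedent, if m = DiaMark, and
   Box (\/ (~P, Q)), in the succedent, if m = BoxMark. *)
Definition is_block (d : mark * {mset form} * {mset form}) : bool :=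
  let: (_, P, Q) := d in
  [&& all atomic P, all atomic Q & (P != mset0) || (Q != mset0)].

Definition block : Type := {d : mark * {mset form} * {mset form} | is_block d}.

(* The middle part consisting of the single block (m, P, Q), or the empty
   middle part if P and Q are both empty.  Always used with P and Q atomic. *)
Definition blk (m : mark) (P Q : {mset form}) : {mset block} :=
  if insub (m, P, Q) is Some b then [mset b] else mset0.

(* Gamma; P |- Q; Delta.  A middle part P |- Q whose occurrences are
   partitioned into marked nonempty blocks is the multiset of these blocks:
   P (resp. Q) is the sum of the left (resp. right) parts of the blocks. *)
Record sequent : Type := Sequent {
  ant : {mset form};
  mid : {mset block};
  suc : {mset form}
}.

Inductive axiom : sequent -> Prop :=
| Ax_id p G K D : atomic p ->
    axiom (Sequent (p +` G) K (p +` D))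
| Ax_bot G K D :
    axiom (Sequent (Bot +` G) K D).

(* rule1 premise conclusion *)
Inductive rule1 : sequent -> sequent -> Prop :=
| R_negL A G K D :
    rule1 (Sequent G K (A +` D))
          (Sequent (Neg A +` G) K D)
| R_negR A G K D :
    rule1 (Sequent (A +` G) K D)
          (Sequent G K (Neg A +` D))
| R_orR A B G K D :
    rule1 (Sequent G K (A +` (B +` D)))
          (Sequent G K (Or A B +` D))
| R_andL A B G K D :
    rule1 (Sequent (A +` (B +` G)) K D)
          (Sequent (And A B +` G) K D)
| R_impR A B G K D :
    rule1 (Sequent (A +` G) K (B +` D))
          (Sequent G K (Imp A B +` D))
| R_diaR A G K D :
    rule1 (Sequent G K (A +` (Dia A +` D)))
          (Sequent G K (Dia A +` D))
| R_boxL A G K D :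
    rule1 (Sequent (A +` (Box A +` G)) K D)
          (Sequent (Box A +` G) K D)
| R_diaL A (M N P1 Q1 : {mset form}) K :
    all modal M -> all modal N -> all atomic P1 -> all atomic Q1 ->
    rule1 (Sequent (A +` M) (blk BoxMark P1 Q1 `+` K) N)
          (Sequent (Dia A +` (M `+` P1)) K (Q1 `+` N))
| R_boxR A (M N P1 Q1 : {mset form}) K :
    all modal M -> all modal N -> all atomic P1 -> all atomic Q1 ->
    rule1 (Sequent M (blk DiaMark P1 Q1 `+` K) (A +` N))
          (Sequent (M `+` P1) K (Box A +` (Q1 `+` N)))
| R_diaL_mid (M N P1 Q1 P2 Q2 : {mset form}) K :
    all modal M -> all modal N -> all atomic P1 -> all atomic Q1 ->
    all atomic P2 -> all atomic Q2 -> (P2 != mset0) || (Q2 != mset0) ->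
    rule1 (Sequent (M `+` P2) (blk BoxMark P1 Q1 `+` K) (Q2 `+` N))
          (Sequent (M `+` P1) (blk DiaMark P2 Q2 `+` K) (Q1 `+` N))
| R_boxR_mid (M N P1 Q1 P2 Q2 : {mset form}) K :
    all modal M -> all modal N -> all atomic P1 -> all atomic Q1 ->
    all atomic P2 -> all atomic Q2 -> (P2 != mset0) || (Q2 != mset0) ->
    rule1 (Sequent (M `+` P2) (blk DiaMark P1 Q1 `+` K) (Q2 `+` N))
          (Sequent (M `+` P1) (blk BoxMark P2 Q2 `+` K) (Q1 `+` N)).

(* rule2 left_premise right_premise conclusion *)
Inductive rule2 : sequent -> sequent -> sequent -> Prop :=
| R_orL A B G K D :
    rule2 (Sequent (A +` G) K D)
          (Sequent (B +` G) K D)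
          (Sequent (Or A B +` G) K D)
| R_andR A B G K D :
    rule2 (Sequent G K (A +` D))
          (Sequent G K (B +` D))
          (Sequent G K (And A B +` D))
| R_impL A B G K D :
    rule2 (Sequent G K (A +` D))
          (Sequent (B +` G) K D)
          (Sequent (Imp A B +` G) K D).

(* deriv h s: s has a derivation of height exactly h. *)
Inductive deriv : nat -> sequent -> Prop :=
| deriv_axiom s : axiom s -> deriv 0 s
| deriv_rule1 h s1 s : rule1 s1 s -> deriv h s1 -> deriv h.+1 s
| deriv_rule2 h1 h2 s1 s2 s : rule2 s1 s2 s ->
    deriv h1 s1 -> deriv h2 s2 -> deriv (maxn h1 h2).+1 s.

Definition provable_le (n : nat) (s : sequent) : Prop :=
  exists2 h : nat, h <= n & deriv h s.

Definition provable (s : sequent) : Prop := exists h : nat, deriv h s.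

(* Main.v *)
(* Replace every sequent by an unmarked one over signed formulas: a current world S
   and a multiset K of further worlds holding atoms only.  The mark of a block only
   decides which of the two symmetric rules opens it, so the two calculi prove the
   same sequents with the same height (ple_der, der_ple).  In the unmarked calculus
   a derivation survives, with the same height, any map between worlds that fixes
   the current one and sends each world to one with at least the same set of atoms
   (der_mono); this contains contraction of atoms as well as the merging of worlds.
   Contraction of A is then by induction on A.  The propositional rules are
   invertible, and Dia on the right and Box on the left keep their principal formula.
   For Dia B on the left (dually Box B on the right), the rule L-Dia is not
   invertible into the current world, but Dia B may be replaced by each leaf U of the
   propositional decomposition of B: its modal formulas go to the current world and
   its atoms to a new one (jump_inv).  When one copy of Dia B is jumped from, this
   applied to the other copy, merging the new world and contracting the modal
   formulas of U, which are no larger than B, yields a single copy. *)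
Require Import Defs.
From mathcomp Require Import all_boot.
From mathcomp Require Import finmap multiset.
From mathcomp Require Import zify.
Local Open Scope mset_scope.

Set Implicit Arguments.
Unset Strict Implicit.
Unset Printing Implicit Defensive.

(** * Finite multisets: cancellation, induction and filtering *)

Section Multisets.
Variable T : choiceType.
Implicit Types (A B C : {mset T}) (x y : T).

Lemma mset1D_inj x A B : x +` A = x +` B -> A = B.
Proof. by move=> /(congr1 (fun C => C `\ x)); rewrite !msetD1K. Qed.

(** Locates a chosen formula relative to the principal one in case analyses on the last rule. *)
Lemma mset1D_eq x y A B : x +` A = y +` B ->
  x = y /\ A = B \/ x <> y /\ exists2 C, A = y +` C & B = x +` C.
Proof.
have [<- /mset1D_inj ->|xy E] := eqVneq x y; [by left | right].
split; first exact/eqP.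
have yA : y \in A.
  have : y \in y +` B by rewrite mset1D1.
  by rewrite -E in_mset1D eq_sym (negbTE xy).
exists (A `\ y); first by rewrite msetB1K.
apply: (@mset1D_inj y); rewrite -E msetDCA msetB1K //.
Qed.

Lemma mset1D_mem x A : x \in A -> exists B, A = x +` B.
Proof. by move=> xA; exists (A `\ x); rewrite msetB1K. Qed.

Lemma perm_msetD A B : perm_eq (A `+` B) (A ++ B).
Proof. by apply/allP => x _; rewrite /= count_cat !count_mem_mset msetE2. Qed.

Lemma perm_mset1D x A : perm_eq (x +` A) (x :: A).
Proof.
by apply: perm_trans (perm_msetD _ _) _; rewrite enum_msetn perm_refl.
Qed.

Lemma all_msetD (P : pred T) A B : all P (A `+` B) = all P A && all P B.
Proof. by rewrite (perm_all _ (perm_msetD A B)) all_cat. Qed.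

Lemma all_mset1D (P : pred T) x A : all P (x +` A) = P x && all P A.
Proof. by rewrite (perm_all _ (perm_mset1D x A)). Qed.

Lemma mset1D_ind (P : {mset T} -> Prop) :
  P mset0 -> (forall x A, P A -> P (x +` A)) -> forall A, P A.
Proof.
move=> P0 PS A; rewrite -(seq_mset_id A); elim: (A : seq T) => [|x s IH].
  by rewrite (_ : seq_mset [::] = mset0) //; apply/msetP => x; rewrite mset_seqE mset0E.
by rewrite mset_cons; apply: PS.
Qed.

Definition mfilter (P : pred T) A : {mset T} := seq_mset (filter P A).

Lemma mfilterE P A x : mfilter P A x = if P x then A x else 0.
Proof.
rewrite /mfilter mset_seqE; case: ifP => Px.
  rewrite -count_mem_mset count_filter; apply: eq_count => y /=.
  by case: eqP => // ->; rewrite Px.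
by apply/count_memPn; rewrite mem_filter Px.
Qed.

Lemma mfilterD P A B : mfilter P (A `+` B) = mfilter P A `+` mfilter P B.
Proof. by apply/msetP => x; rewrite msetE2 !mfilterE msetE2; case: ifP. Qed.

Lemma mfilter1 P x : mfilter P [mset x] = if P x then [mset x] else mset0.
Proof.
apply/msetP => y; rewrite mfilterE msetnE (fun_if (fun A : {mset T} => A y)).
by rewrite msetnE mset0E; have [->|] := eqVneq y x; do ?case: ifP.
Qed.

Lemma in_mfilter P A x : (x \in mfilter P A) = P x && (x \in A).
Proof. by rewrite !in_mset mfilterE; case: ifP. Qed.

Lemma mfilter_id P A : all P A -> mfilter P A = A.
Proof. by move=> PA; rewrite /mfilter (all_filterP PA) seq_mset_id. Qed.

Lemma mfilterC P A : mfilter P A `+` mfilter (predC P) A = A.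
Proof. by apply/msetP => x; rewrite msetE2 !mfilterE /=; case: ifP; rewrite ?addn0. Qed.

Lemma mfilter_nil P A : all (predC P) A -> mfilter P A = mset0.
Proof.
move=> /allP PA; apply/msetP => x; rewrite mfilterE mset0E; case: ifP => // Px.
by apply/mset_eq0P; apply/negP => /PA /=; rewrite Px.
Qed.

End Multisets.

Ltac mset_ac :=
  apply/msetP => ?; rewrite !(msetE2, mset0E); lia.

(** * Signed formulas and the unmarked calculus of worlds *)

(* [true] marks formulas of the antecedent, [false] those of the succedent. *)
Local Notation sform := (bool * form)%type.
Local Notation T A := (true, A).
Local Notation F A := (false, A).

Implicit Types (S : {mset sform}) (K : {mset {mset sform}}) (a b x : sform).

Definition satom : pred sform := fun x => atomic x.2.
Definition smodal : pred sform := fun x => modal x.2.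

(* The premises of the local rules, as the multisets replacing the principal formula. *)
Definition dec a : option (seq {mset sform}) :=
  match a with
  | T (Neg A) => Some [:: [mset F A]]
  | F (Neg A) => Some [:: [mset T A]]
  | T (And A B) => Some [:: T A +` [mset T B]]
  | F (And A B) => Some [:: [mset F A]; [mset F B]]
  | T (Or A B) => Some [:: [mset T A]; [mset T B]]
  | F (Or A B) => Some [:: F A +` [mset F B]]
  | T (Imp A B) => Some [:: [mset F A]; [mset T B]]
  | F (Imp A B) => Some [:: T A +` [mset F B]]
  | F (Dia A) => Some [:: F A +` [mset F (Dia A)]]
  | T (Box A) => Some [:: T A +` [mset T (Box A)]]
  | _ => None
  end.

Definition jump a : option sform :=
  match a with
  | T (Dia A) => Some (T A)
  | F (Box A) => Some (F A)
  | _ => None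
  end.

Definition apart S := mfilter satom S.
Definition npart S := mfilter (predC satom) S.

(* Blocks of actual sequents are atomic, so that [apart P] is [P] in [der_open].
   In contrast to G3S5; empty blocks may be created and opened, which makes the
   rules uniform and is harmless by [der_mono]. *)
Inductive der : nat -> {mset sform} -> {mset {mset sform}} -> Prop :=
| der_id n p S K : atomic p -> T p \in S -> F p \in S -> der n S K
| der_bot n S K : T Bot \in S -> der n S K
| der_local n a ps S K : dec a = Some ps ->
    (forall p, p \in ps -> der n (p `+` S) K) -> der n.+1 (a +` S) K
| der_jump n a b S K : jump a = Some b -> all smodal (npart S) ->
    der n (b +` npart S) (apart S +` K) -> der n.+1 (a +` S) K
| der_open n S P K : all smodal (npart S) ->
    der n (npart S `+` apart P) (apart S +` K) -> der n.+1 S (P +` K).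

Lemma npartD S S' : npart (S `+` S') = npart S `+` npart S'.
Proof. exact: mfilterD. Qed.
Lemma apartD S S' : apart (S `+` S') = apart S `+` apart S'.
Proof. exact: mfilterD. Qed.
Lemma npart1 a : npart [mset a] = if satom a then mset0 else [mset a].
Proof. by rewrite /npart mfilter1 /=; case: (satom a). Qed.
Lemma apart1 a : apart [mset a] = if satom a then [mset a] else mset0.
Proof. exact: mfilter1. Qed.
Lemma partE S : npart S `+` apart S = S.
Proof. by rewrite msetDC mfilterC. Qed.
Lemma npart_id S : npart (npart S) = npart S.
Proof. by apply/msetP => x; rewrite !mfilterE /=; case: (satom x). Qed.
Lemma apart_id S : apart (apart S) = apart S.
Proof. by apply/msetP => x; rewrite !mfilterE /=; case: (satom x). Qed.
Lemma npart_apart S : npart (apart S) = mset0.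
Proof. by apply/msetP => x; rewrite !mfilterE mset0E /=; case: (satom x). Qed.
Lemma apart_npart S : apart (npart S) = mset0.
Proof. by apply/msetP => x; rewrite !mfilterE mset0E /=; case: (satom x). Qed.
Lemma in_apart S x : (x \in apart S) = satom x && (x \in S).
Proof. exact: in_mfilter. Qed.
Lemma in_npart S x : (x \in npart S) = ~~ satom x && (x \in S).
Proof. exact: in_mfilter. Qed.

Lemma smodal_natom a : smodal a -> ~~ satom a.
Proof. by case: a => [[] []]. Qed.
Lemma jump_smodal a b : jump a = Some b -> smodal a.
Proof. by case: a => [[] []]. Qed.
Lemma dec_natom a ps : dec a = Some ps -> ~~ satom a.
Proof. by case: a => [[] []]. Qed.

(** * Height weakening and maps between worlds *)

Definition sub_atoms S S' := forall x, satom x -> x \in S -> x \in S'.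
(** A map of worlds that may send a block to the current world. Several worlds may share an image,
    which is what lets worlds merge. *)
Definition covers S' K' K := forall P, P \in K ->
  sub_atoms P S' \/ exists2 P', P' \in K' & sub_atoms P P'.

Lemma der_le n m S K : n <= m -> der n S K -> der m S K.
Proof.
move=> le_nm H; elim: H m le_nm => {n S K}.
- by move=> n p S K ap Hl Hr m _; apply: (@der_id m p).
- by move=> n S K Hb m _; apply: der_bot.
- move=> n a ps S K Ha _ IH [//|m] le_nm.
  by apply: der_local Ha _ => p pps; apply: (IH p pps).
- by move=> n a b S K Ha mS _ IH [//|m] le_nm; exact: (der_jump Ha mS (IH m le_nm)).
- move=> n S P K mS _ IH m le_nm; case: m le_nm => [//|m] le_nm.
  exact: (der_open mS (IH m le_nm)).
Qed.

(* Atoms matter only as sets and worlds only through their atoms, hence merging a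
   block into another world, contracting an atom, weakening by atoms and discarding
   empty blocks are all instances of this statement. *)
Lemma der_mono n S K S' K' : der n S K -> npart S = npart S' ->
  sub_atoms S S' -> covers S' K' K -> der n S' K'.
Proof.
move=> H; elim: H S' K' => {n S K}.
- move=> n p S K ap Hl Hr S' K' _ sub _.
  by apply: (@der_id n p) => //; apply: sub.
- by move=> n S K Hb S' K' _ sub _; apply: der_bot; apply: sub.
- move=> n a ps S K Ha _ IH S' K' eN sub cov.
  have na := dec_natom Ha.
  have aS' : a \in S'.
    have : a \in npart S' by rewrite -eN in_npart na mset1D1.
    by rewrite in_npart => /andP[].
  case: (mset1D_mem aS') => S'' E; subst S'.
  move: eN; rewrite !npartD npart1 (negbTE na) => /mset1D_inj eN.
  have sub' : sub_atoms S S''.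
    move=> x ax xS; have := sub x ax; rewrite !in_mset1D xS orbT => /(_ isT).
    by case: eqP ax na => // -> ->.
  apply: der_local Ha _ => p pps; apply: (IH p pps).
  + by rewrite !npartD eN.
  + move=> x ax; rewrite !in_msetD => /orP[->//|/sub'->//]; by rewrite orbT.
  + move=> P /cov [subP|]; last by right.
    left=> x ax /subP -/(_ ax); rewrite in_mset1D in_msetD.
    by case: eqP ax na => [-> ->|_ _ _ /= ->] //; rewrite orbT.
- move=> n a b S K Ha mS _ IH S' K' eN sub cov.
  have na := smodal_natom (jump_smodal Ha).
  have aS' : a \in S'.
    have : a \in npart S' by rewrite -eN in_npart na mset1D1.
    by rewrite in_npart => /andP[].
  case: (mset1D_mem aS') => S'' E; subst S'.
  move: eN; rewrite !npartD npart1 (negbTE na) => /mset1D_inj eN.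
  have drop_a x : satom x -> x \in a +` S'' -> x \in S''.
    by move=> ax; rewrite in_mset1D; case: eqP ax na => // -> ->.
  apply: der_jump Ha _ _; first by rewrite -eN.
  apply: IH; rewrite ?eN //.
  move=> P; rewrite in_mset1D => /orP[/eqP->|/cov[subP|[P' P'K subP]]]; right.
  + exists (apart S''); first by rewrite mset1D1.
    move=> x ax; rewrite !in_apart ax /= => xS; apply: drop_a => //.
    by apply: sub; rewrite // in_mset1D xS orbT.
  + exists (apart S''); first by rewrite mset1D1.
    by move=> x ax xP; rewrite in_apart ax; apply: drop_a => //; apply: subP.
  + by exists P' => //; rewrite in_mset1D P'K orbT.
- move=> n S P K mS _ IH S' K' eN sub cov.
  have [subP|[P' P'K subP]] := cov P (mset1D1 _ _).
  + apply: (der_le (leqnSn n)); apply: IH.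
    * by rewrite npartD npart_id npart_apart msetD0.
    * move=> x ax; rewrite in_msetD in_npart in_apart ax /=; exact: subP.
    * move=> Q; rewrite in_mset1D => /orP[/eqP->|QK].
        by left=> x ax; rewrite in_apart ax; apply: sub.
      by apply: cov; rewrite in_mset1D QK orbT.
  (* [P] is mapped to [P'], so [P'] is opened instead. Worlds mapped to the old current world now go
     to its block of atoms, those mapped to [P'] to the new current world. *)
  + case: (mset1D_mem P'K) => K'' E; subst K'.
    apply: der_open; rewrite -eN //; apply: IH.
    * by rewrite !npartD !npart_apart.
    * move=> x ax; rewrite !in_msetD !in_apart ax => /orP[->//|/subP->//].
      by rewrite orbT.
    * move=> Q; rewrite in_mset1D => /orP[/eqP->|QK].
        right; exists (apart S'); first by rewrite mset1D1.
        by move=> x ax; rewrite !in_apart ax; apply: sub.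
 have QPK : Q \in P +` K by rewrite in_mset1D QK orbT.
      have [subQ|[Q']] := cov Q QPK.
        right; exists (apart S'); first by rewrite mset1D1.
        by move=> x ax xQ; rewrite in_apart ax; apply: subQ.
      rewrite in_mset1D => /orP[/eqP->|Q'K] subQ.
        by left=> x ax xQ; rewrite in_msetD in_apart ax subQ // orbT.
      by right; exists Q' => [|//]; rewrite in_mset1D Q'K orbT.
Qed.

(** * Inversion, persistent formulas and replacement of jump formulas *)

Definition pder S K := exists n, der n S K.

(** A formula neither atomic nor modal blocks every change of world, so only axioms and local rules
    can end the derivation, and these commute with the decomposition of [a]. *)
Lemma dec_inv a ps n S K p : dec a = Some ps -> ~~ smodal a ->
  p \in ps -> der n (a +` S) K -> der n (p `+` S) K.
Proof.
move=> Ha ma pps; move E: (a +` S) => R H; have na := dec_natom Ha.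
elim: H S E => {n R K}.
- move=> n q R K aq Hl Hr S E; subst R; apply: (@der_id n q) => //.
  + by move: Hl; rewrite in_mset1D in_msetD; case: eqP na => [<-|_ _ /= ->]; rewrite ?orbT //= /satom aq.
  + by move: Hr; rewrite in_mset1D in_msetD; case: eqP na => [<-|_ _ /= ->]; rewrite ?orbT //= /satom aq.
- move=> n R K Hb S E; subst R; apply: der_bot.
  by move: Hb; rewrite in_mset1D in_msetD; case: eqP na => [<-|_ _ /= ->]; rewrite ?orbT.
- move=> n a' ps' R K Ha' D IH S E.
  have [[Ea ES]|[_ [U -> ER]]] := mset1D_eq E.
    subst a' S; move: Ha'; rewrite Ha => -[Eps]; subst ps'.
    exact: (der_le (leqnSn n) (D p pps)).
  rewrite msetDCA; apply: der_local Ha' _ => q qps; rewrite msetDCA.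
  by apply: (IH q qps); rewrite ER msetDCA.
- move=> n a' b R K Ha' mR _ _ S E; exfalso.
  have [[Ea _]|[_ [U _ ER]]] := mset1D_eq E.
    by move: ma; rewrite Ea (jump_smodal Ha').
  move: mR; rewrite ER npartD npart1 (negbTE na) all_mset1D.
  by rewrite (negbTE ma).
- move=> n R P K mR _ _ S E; exfalso; subst R.
  by move: mR; rewrite npartD npart1 (negbTE na) all_mset1D (negbTE ma).
Qed.

(** The premise of the rule on [a] still contains both copies, next to [b], so they are contracted
    there and the rule is applied again. As [a] is modal, both copies follow every change of
    world. *)
Lemma contr_persistent a b n S K : dec a = Some [:: b +` [mset a]] -> smodal a ->
  der n (a +` (a +` S)) K -> der n (a +` S) K.
Proof.
move=> Ha ma; move E: (a +` (a +` S)) => R H; have na := dec_natom Ha.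
elim: H S E => {n R K}.
- move=> n q R K aq Hl Hr S E; subst R; apply: (@der_id n q) => //.
  + by move: Hl; rewrite !in_mset1D orbA orbb.
  + by move: Hr; rewrite !in_mset1D orbA orbb.
- move=> n R K Hb S E; subst R; apply: der_bot.
  by move: Hb; rewrite !in_mset1D orbA orbb.
- move=> n a' ps' R K Ha' D IH S E.
  have [[Ea ES]|[naa [U EU ER]]] := mset1D_eq E.
    subst a' R; apply: (der_local Ha') => p pps.
    have := IH p pps (b +` S); move: Ha' pps; rewrite Ha => -[<-].
    rewrite inE => /eqP ->; rewrite -!msetDA [b +` (a +` S)]msetDCA.
    apply; mset_ac.
  case: (mset1D_eq EU) => [[//]|[_ [V -> EV]]].
  rewrite msetDCA; apply: der_local Ha' _ => q qps; rewrite msetDCA.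
  by apply: (IH q qps); rewrite ER EV; mset_ac.
- move=> n a' b' R K Ha' mR _ IH S E.
  have [[Ea ES]|[naa [U EU ER]]] := mset1D_eq E.
    by move: Ha Ha'; rewrite Ea; case: (a') => [[] []].
  case: (mset1D_eq EU) => [[//]|[_ [V -> EV]]].
  move: mR IH; rewrite ER EV !npartD !apartD npart1 apart1 (negbTE na) !mset0D.
  rewrite !all_mset1D ma /= => mR IH.
  rewrite msetDCA; apply: der_jump Ha' _ _; rewrite !npartD npart1 (negbTE na) ?all_mset1D ?ma //.
  rewrite apartD apart1 (negbTE na) mset0D msetDCA; apply: IH; mset_ac.
- move=> n R P K mR _ IH S E; subst R.
  move: mR IH; rewrite !npartD !apartD npart1 apart1 (negbTE na) !mset0D.
  rewrite !all_mset1D ma /= => mR IH.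
  apply: der_open; rewrite !npartD npart1 (negbTE na) ?all_mset1D ?ma //.
  by rewrite apartD apart1 (negbTE na) mset0D -msetDA; apply: IH; mset_ac.
Qed.

Lemma pder_local a ps S K : dec a = Some ps ->
  (forall p, p \in ps -> pder (p `+` S) K) -> pder (a +` S) K.
Proof.
move=> Ha D.
have [n Dn] : exists n, forall p, p \in ps -> der n (p `+` S) K.
  elim: ps D {Ha} => [|p ps IH] D; first by exists 0.
  have [n Dn] : exists n, forall q, q \in ps -> der n (q `+` S) K.
    by apply: IH => q qps; apply: D; rewrite inE qps orbT.
  have [m Dm] := D p (mem_head _ _).
  exists (maxn n m) => q; rewrite inE => /orP[/eqP->|qps].
    exact: (der_le (leq_maxr n m) Dm).
  exact: (der_le (leq_maxl n m) (Dn q qps)).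
by exists n.+1; apply: (der_local Ha).
Qed.

(** Records a chain of inversions by its effect alone; [hp] stands for height-preserving. *)
Definition entails_hp S S' := forall n R K, der n (S `+` R) K -> der n (S' `+` R) K.

(** Where [a] is jumped from, the premise with [b] replaced by [U] is also the premise of opening
    the block [apart U] while [npart U] moves along. One rule replaces one rule, so the height is
    kept. *)
Lemma jump_inv a b U n S K : jump a = Some b -> all smodal (npart U) ->
  entails_hp [mset b] U ->
  der n (a +` S) K -> der n (npart U `+` S) (apart U +` K).
Proof.
move=> Ha mU bU; move E: (a +` S) => R H.
have ma := jump_smodal Ha; have na := smodal_natom ma.
elim: H S E => {n R K}.
- move=> n q R K aq Hl Hr S E; subst R; apply: (@der_id n q) => //.
  + by move: Hl; rewrite in_mset1D in_msetD; case: eqP na => [<-|_ _ /= ->]; rewrite ?orbT //= /satom aq.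
  + by move: Hr; rewrite in_mset1D in_msetD; case: eqP na => [<-|_ _ /= ->]; rewrite ?orbT //= /satom aq.
- move=> n R K Hb S E; subst R; apply: der_bot.
  by move: Hb; rewrite in_mset1D in_msetD; case: eqP na => [<-|_ _ /= ->]; rewrite ?orbT.
- move=> n a' ps' R K Ha' D IH S E.
  have [[Ea ES]|[_ [V -> ER]]] := mset1D_eq E.
    by move: Ha Ha'; rewrite Ea; case: (a') => [[] []].
  rewrite msetDCA; apply: der_local Ha' _ => q qps; rewrite msetDCA.
  by apply: (IH q qps); rewrite ER msetDCA.
- move=> n a' b' R K Ha' mR D IH S E.
  have [[Ea ES]|[naa [V -> ER]]] := mset1D_eq E.
    subst a' S; move: Ha'; rewrite Ha => -[eb]; subst b'.
    apply: der_open; first by rewrite npartD all_msetD npart_id mU.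
    rewrite npartD apartD npart_id apart_npart mset0D apart_id.
    have := bU _ _ _ D; rewrite -{1}(partE U).
    by rewrite -!msetDA [apart U `+` _]msetDC.
  move: mR IH; rewrite ER !npartD !apartD npart1 apart1 (negbTE na) !mset0D.
  rewrite all_mset1D ma /= => mR IH.
  rewrite msetDCA; apply: der_jump Ha' _ _; rewrite npartD npart_id.
    by rewrite all_msetD mU.
  rewrite apartD apart_npart mset0D msetDCA [X in der _ _ X]msetDCA; apply: IH; mset_ac.
- move=> n R P K mR _ IH S E; subst R.
  move: mR IH; rewrite !npartD !apartD npart1 apart1 (negbTE na) !mset0D.
  rewrite all_mset1D ma /= => mR IH.
  rewrite msetDCA.
  apply: der_open; rewrite npartD npart_id; first by rewrite all_msetD mU.
  rewrite apartD apart_npart mset0D [X in der _ _ X]msetDCA -msetDA; apply: IH; mset_ac.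
Qed.

(** * Size of formulas and propositional decomposition into leaves *)

Fixpoint form_size (A : form) : nat :=
  match A with
  | Bot | Var _ => 0
  | Neg A | Dia A | Box A => (form_size A).+1
  | And A B | Or A B | Imp A B => (form_size A + form_size B).+1
  end.

Definition weight S := \sum_(x <- S) form_size x.2.

Lemma weightD S S' : weight (S `+` S') = weight S + weight S'.
Proof. by rewrite /weight (perm_big _ (perm_msetD S S')) big_cat. Qed.

Lemma weight1 a : weight [mset a] = form_size a.2.
Proof. by rewrite /weight enum_msetn big_seq1. Qed.

Definition size_le k S := all (fun x => form_size x.2 <= k) S.

Lemma size_leD k S S' : size_le k (S `+` S') = size_le k S && size_le k S'.
Proof. exact: all_msetD. Qed.

Lemma size_le1 k a : size_le k [mset a] = (form_size a.2 <= k).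
Proof. by rewrite /size_le enum_msetn /= andbT. Qed.

Lemma dec_weight a ps p : dec a = Some ps -> ~~ smodal a -> p \in ps ->
  weight p < form_size a.2.
Proof.
by case: a => [[] [|n|A|A B|A B|A B|A|A]] //= -[<-] _; rewrite !inE;
  do ?[case/orP]; move/eqP->; rewrite ?weightD !weight1 /=; lia.
Qed.

Lemma mem_weight x S : x \in S -> form_size x.2 <= weight S.
Proof. by case/mset1D_mem => R ->; rewrite weightD weight1 leq_addr. Qed.

Lemma dec_some a : ~~ smodal a -> ~~ satom a -> exists ps, dec a = Some ps.
Proof. by case: a => [[] []] //= *; eexists. Qed.

(* The [U] here stand for the leaves of the propositional decomposition of [X]. *)
Lemma pder_leaves k X R K : size_le k X ->
  (forall U, all smodal (npart U) -> size_le k U -> entails_hp X U ->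
     pder (U `+` R) K) ->
  pder (X `+` R) K.
Proof.
have [m] := ubnP (weight X); elim: m X => [//|m IH] X wX kX leaf.
case/boolP: (all smodal (npart X)) => [mX|/allPn[a]]; first exact: leaf.
rewrite in_npart => /andP[na aX] ma.
have [X' EX] := mset1D_mem aX; subst X => {aX}.
have [ps Ha] := dec_some ma na.
rewrite -msetDA; apply: (pder_local Ha) => p pps; rewrite msetDA.
have lt := dec_weight Ha ma pps.
apply: IH.
- by move: wX; rewrite !weightD weight1; lia.
- move: kX; rewrite !size_leD size_le1 => /andP[ka ->]; rewrite andbT.
  apply/allP => x /mem_weight /=; lia.
(* A leaf of the premise is a leaf of the conclusion: the inversion of [a] is put in front of the
   chain. *)
- move=> U mU kU XU; apply: leaf => // n Q L; rewrite -msetDA => D.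
  apply: XU; rewrite -msetDA; exact: (dec_inv Ha ma pps D).
Qed.

(** * Contraction in the unmarked calculus *)

Definition contractible a := forall S K, pder (a +` (a +` S)) K -> pder (a +` S) K.

Lemma contract_mset X R K : (forall x, x \in X -> contractible x) ->
  pder (X `+` (X `+` R)) K -> pder (X `+` R) K.
Proof.
elim/mset1D_ind: X R => [|x X IH] R cX; first by rewrite !mset0D.
move=> D; rewrite -msetDA; apply: (cX x (mset1D1 _ _)).
have -> : x +` (x +` (X `+` R)) = X `+` (x +` (x +` R)) by mset_ac.
apply: IH => [y yX|]; first by apply: cX; rewrite in_mset1D yX orbT.
suff -> : X `+` (X `+` (x +` (x +` R))) = x +` X `+` (x +` X `+` R) by [].
mset_ac.
Qed.

(* When [a] itself is jumped from, the other copy of [a] yields, for each leaf [U]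
   of [b], the modal part of [U] in place and a block with the atoms of [U];
   both are absorbed by the copy of [U] in the new world. *)
Lemma contract_jump a b S K : jump a = Some b ->
  (forall x, form_size x.2 <= form_size b.2 -> contractible x) ->
  pder (a +` (a +` S)) K -> pder (a +` S) K.
Proof.
move=> Ha cb [n]; move E: (a +` (a +` S)) => R H.
have ma := jump_smodal Ha; have na := smodal_natom ma.
elim: H S E => {n R K}.
- move=> n q R K aq Hl Hr S E; subst R; exists 0; apply: (@der_id 0 q) => //.
  + by move: Hl; rewrite !in_mset1D orbA orbb.
  + by move: Hr; rewrite !in_mset1D orbA orbb.
- move=> n R K Hb S E; subst R; exists 0; apply: der_bot.
  by move: Hb; rewrite !in_mset1D orbA orbb.
- move=> n a' ps' R K Ha' D IH S E.
  have [[Ea ES]|[naa [U EU ER]]] := mset1D_eq E.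
    by move: Ha Ha'; rewrite Ea; case: (a') => [[] []].
  case: (mset1D_eq EU) => [[//]|[_ [V -> EV]]].
  rewrite msetDCA; apply: pder_local Ha' _ => q qps; rewrite msetDCA.
  by apply: (IH q qps); rewrite ER EV; mset_ac.
- move=> n a' b' R K Ha' mR D IH S E.
  have [[Ea ER]|[naa [U EU ER]]] := mset1D_eq E.
    subst a' R; move: Ha'; rewrite Ha => -[eb]; subst b'.
    move: mR D; rewrite npartD apartD npart1 apart1 (negbTE na) mset0D.
    rewrite all_mset1D ma /= => mS D.
    suff [m Dm] : pder (b +` npart S) (apart S +` K).
      by exists m.+1; apply: der_jump Ha mS Dm.
    (* Each leaf [U] of [b] is treated separately in the new world. Reassembling [b] from its leaves
       costs propositional steps, so height is not tracked. *)
    apply: (@pder_leaves (form_size b.2)); first by rewrite size_le1.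
    move=> U mU kU bU.
    (* [b] becomes [U]; then the copy of [a] that moved along is replaced by [npart U] in place and
       a block [apart U]. *)
    have {}D := bU _ _ _ D; rewrite msetDCA in D.
    have {}D := jump_inv Ha mU bU D.
    rewrite -(partE U) -msetDA; apply: contract_mset.
      move=> x; rewrite in_npart => /andP[_ /(allP kU)]; exact: cb.
    (* The block [apart U] is merged into the current world, which already has these atoms. *)
    exists n; apply: (der_mono D).
    + by rewrite !npartD !npart_id npart_apart mset0D.
    + by move=> x ax; rewrite !in_msetD !in_npart !in_apart ax.
    + move=> P; rewrite in_mset1D => /orP[/eqP->|PK].
        left=> x ax; rewrite !in_msetD !in_apart => /andP[_ ->].
        by rewrite ax !orbT.
      by right; exists P => // x ax.
  case: (mset1D_eq EU) => [[//]|[_ [V -> EV]]].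
  move: mR IH; rewrite ER EV !npartD !apartD npart1 apart1 (negbTE na) !mset0D.
  rewrite !all_mset1D ma /= => mR IH.
  have [m Dm] : pder (a +` (b' +` npart V)) (apart V +` K) by apply: IH; mset_ac.
  exists m.+1; rewrite msetDCA; apply: der_jump Ha' _ _.
    by rewrite npartD npart1 (negbTE na) all_mset1D ma.
  by rewrite npartD apartD npart1 apart1 (negbTE na) mset0D msetDCA.
- move=> n R P K mR _ IH S E; subst R.
  move: mR IH; rewrite !npartD !apartD npart1 apart1 (negbTE na) !mset0D.
  rewrite !all_mset1D ma /= => mR IH.
  have [m Dm] : pder (a +` (npart S `+` apart P)) (apart S +` K) by apply: IH; mset_ac.
  exists m.+1; apply: der_open.
    by rewrite npartD npart1 (negbTE na) all_mset1D ma.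
  by rewrite npartD apartD npart1 apart1 (negbTE na) mset0D -msetDA.
Qed.

Lemma contract_atom n a S K : satom a ->
  der n (a +` (a +` S)) K -> der n (a +` S) K.
Proof.
move=> aa D; apply: (der_mono D).
- by rewrite !npartD npart1 aa !mset0D.
- by move=> x _; rewrite !in_mset1D orbA orbb.
- by move=> P PK; right; exists P => // x.
Qed.

Lemma contract a : contractible a.
Proof.
have [m] := ubnP (form_size a.2); elim: m a => [//|m IH] a lt_m S K D.
case/boolP: (satom a) => [aa|na].
  by case: D => n D; exists n; apply: contract_atom.
case/boolP: (smodal a) => [ma|nma].
  case Ha: (jump a) => [b|].
    apply: (contract_jump Ha _ D) => x lt_x; apply: IH.
    by move: a Ha lt_m lt_x {na ma D} => [[] []] //= A [<-] /=; lia.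
  have [b Hb] : exists b, dec a = Some [:: b +` [mset a]].
    by move: a Ha ma {na lt_m D} => [[] []] //= A _ _; eexists.
  by case: D => n D; exists n; apply: (contr_persistent Hb).
(* Both copies are inverted towards the same premise [p], whose members are smaller than [a]; they
   are contracted and the rule is applied once. *)
have [ps Ha] := dec_some nma na.
apply: (pder_local Ha) => p pps; apply: contract_mset.
  by move=> x /mem_weight; have := dec_weight Ha nma pps => *; apply: IH; lia.
case: D => n D; exists n.
have := dec_inv Ha nma pps D; rewrite msetDCA.
exact: (dec_inv Ha nma pps).
Qed.

(** * From marked sequents to worlds of signed formulas *)

Definition sg (G D : {mset form}) : {mset sform} :=
  seq_mset ([seq T A | A <- G] ++ [seq F A | A <- D]).

Lemma sgE G D x : sg G D x = if x.1 then G x.2 else D x.2.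
Proof.
have cnt c d A (s : {mset form}) :
    count (fun B => (c, B) == (d, A)) s = if c == d then s A else 0.
  rewrite -count_mem_mset; have [<-|/negbTE cd] := eqVneq c d.
    by apply: eq_count => B; rewrite /= xpair_eqE eqxx.
  by rewrite -(count_pred0 s); apply: eq_count => B; rewrite /= xpair_eqE cd.
by rewrite /sg mset_seqE count_cat !count_map; case: x => [[] A]; rewrite !cnt ?addn0.
Qed.

Lemma sgD G G' D D' : sg (G `+` G') (D `+` D') = sg G D `+` sg G' D'.
Proof. by apply/msetP => [[[] A]]; rewrite msetE2 !sgE /= msetE2. Qed.

Lemma sg_l A G D : sg (A +` G) D = T A +` sg G D.
Proof.
by apply/msetP => [[[] B]]; rewrite mset1DE xpair_eqE !sgE /= ?mset1DE.
Qed.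

Lemma sg_r A G D : sg G (A +` D) = F A +` sg G D.
Proof.
by apply/msetP => [[[] B]]; rewrite mset1DE xpair_eqE !sgE /= ?mset1DE.
Qed.

Lemma in_sg G D x : (x \in sg G D) = if x.1 then x.2 \in G else x.2 \in D.
Proof. by rewrite !in_mset sgE; case: x.1. Qed.

Lemma all_sg (P : pred form) G D : all (fun x => P x.2) (sg G D) = all P G && all P D.
Proof.
apply/allP/andP => [H|[/allP HG /allP HD] [[] A]]; last 2 first.
- by rewrite in_sg => /HG.
- by rewrite in_sg => /HD.
by split; apply/allP => A AG; [apply: (H (T A)) | apply: (H (F A))]; rewrite in_sg.
Qed.

Section ModalAtomic.
Variables M N P Q : {mset form}.
Hypotheses (mM : all modal M) (mN : all modal N) (aP : all atomic P) (aQ : all atomic Q).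

Lemma sg_split : sg (M `+` P) (Q `+` N) = sg M N `+` sg P Q.
Proof. by rewrite [Q `+` N]msetDC sgD. Qed.

Lemma sg_smodal : all smodal (sg M N).
Proof. by rewrite all_sg mM. Qed.

Lemma sg_satom : all satom (sg P Q).
Proof. by rewrite all_sg aP. Qed.

Lemma sg_natom : all (predC satom) (sg M N).
Proof. by apply: sub_all sg_smodal => x /smodal_natom. Qed.

(** The split into modal and atomic formulas displayed in a modal rule is forced by the sequent,
    hence recovered by filtering. *)
Lemma npart_sg : npart (sg (M `+` P) (Q `+` N)) = sg M N.
Proof.
rewrite sg_split npartD /npart (mfilter_id sg_natom) mfilter_nil ?msetD0 //.
by apply: sub_all sg_satom => x /= ->.
Qed.

Lemma apart_sg : apart (sg (M `+` P) (Q `+` N)) = sg P Q.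
Proof.
by rewrite sg_split apartD /apart (mfilter_id sg_satom) (mfilter_nil sg_natom) mset0D.
Qed.

End ModalAtomic.

(** The translation forgets the mark here. *)
Definition content (d : block) : {mset sform} := sg (val d).1.2 (val d).2.
Definition contents (K : {mset block}) : {mset {mset sform}} :=
  seq_mset [seq content d | d <- K].

Lemma contentsD (K K' : {mset block}) : contents (K `+` K') = contents K `+` contents K'.
Proof.
apply/msetP => P; rewrite msetE2 !mset_seqE -count_cat -map_cat.
exact: (permP (perm_map content (perm_msetD K K'))).
Qed.

Lemma contents1 d : contents [mset d] = [mset content d].
Proof. by apply/msetP => P; rewrite mset_seqE enum_msetn /= addn0 msetnE eq_sym; case: eqP. Qed.

Lemma contentsP (K : {mset block}) P :
  reflect (exists2 d, d \in K & P = content d) (P \in contents K).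
Proof.
rewrite (perm_mem (perm_eq_seq_mset _)); exact: mapP.
Qed.

Lemma blk_block m (P Q : {mset form}) : all atomic P -> all atomic Q ->
  (P != mset0) || (Q != mset0) -> exists2 d, blk m P Q = [mset d] & content d = sg P Q.
Proof.
move=> aP aQ ne; have b : is_block (m, P, Q) by rewrite /= aP aQ.
by exists (Sub _ b : block); rewrite ?/blk ?/content ?insubT.
Qed.

Lemma blkE (d : block) : [mset d] = blk (val d).1.1 (val d).1.2 (val d).2.
Proof.
by rewrite /blk; case: (d) => -[[m P] Q] b; rewrite insubT.
Qed.

(** For empty [P] and [Q] the left side has no block and the right side an empty world, which
    [der_mono] adds or removes at no cost in height. *)
Lemma der_blk m (P Q : {mset form}) n S (K : {mset block}) :
  all atomic P -> all atomic Q ->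
  der n S (contents (blk m P Q `+` K)) <-> der n S (sg P Q +` contents K).
Proof.
move=> aP aQ; rewrite contentsD.
have [ne|] := boolP ((P != mset0) || (Q != mset0)).
  by have [d -> <-] := blk_block m aP aQ ne; rewrite contents1.
rewrite negb_or !negbK => /andP[/eqP-> /eqP->].
have -> : contents (blk m mset0 mset0) = mset0.
  have nb : is_block (m, mset0, mset0) = false by rewrite /= !eqxx !andbF.
  by rewrite /blk (insubF _ nb) /contents enum_mset0; apply/msetP => R; rewrite mset_seqE mset0E.
rewrite mset0D; split=> D; apply: (der_mono D) => // R.
  by move=> RK; right; exists R => //; rewrite in_mset1D RK orbT.
rewrite in_mset1D => /orP[/eqP->|RK]; last by right; exists R.
by left=> x _; rewrite in_sg !in_mset0; case: x.1.
Qed.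

(** Rule by rule. The two rules opening a block differ only in marks, so both become [der_open]; the
    premises of a branching rule are raised to a common height. *)
Lemma der_ple h s : deriv h s -> der h (sg (ant s) (suc s)) (contents (mid s)).
Proof.
elim=> {h s}.
- move=> _ [p G K D ap|G K D] /=; rewrite sg_l.
    by apply: (@der_id _ p); rewrite ?sg_r ?in_mset1D ?eqxx ?orbT.
  by apply: der_bot; rewrite mset1D1.
- move=> h _ _ [].
  + move=> A G K D _ /=; rewrite sg_l sg_r => H.
    by apply: (@der_local _ (T (Neg A)) [:: [mset F A]]) => // p; rewrite inE => /eqP->.
  + move=> A G K D _ /=; rewrite sg_l sg_r => H.
    by apply: (@der_local _ (F (Neg A)) [:: [mset T A]]) => // p; rewrite inE => /eqP->.
  + move=> A B G K D _ /=; rewrite !sg_r msetDA => H.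
    by apply: (@der_local _ (F (Or A B)) [:: F A +` [mset F B]]) => // p; rewrite inE => /eqP->.
  + move=> A B G K D _ /=; rewrite !sg_l msetDA => H.
    by apply: (@der_local _ (T (And A B)) [:: T A +` [mset T B]]) => // p; rewrite inE => /eqP->.
  + move=> A B G K D _ /=; rewrite !sg_l !sg_r msetDA => H.
    by apply: (@der_local _ (F (Imp A B)) [:: T A +` [mset F B]]) => // p; rewrite inE => /eqP->.
  + move=> A G K D _ /=; rewrite !sg_r msetDA => H.
    by apply: (@der_local _ (F (Dia A)) [:: F A +` [mset F (Dia A)]]) => // p; rewrite inE => /eqP->.
  + move=> A G K D _ /=; rewrite !sg_l msetDA => H.
    by apply: (@der_local _ (T (Box A)) [:: T A +` [mset T (Box A)]]) => // p; rewrite inE => /eqP->.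
  + move=> A M N P Q K mM mN aP aQ _ /=; rewrite !sg_l (der_blk _ _ _ _ aP aQ) => H.
    apply: (@der_jump _ (T (Dia A)) (T A) _ _ erefl).
      by rewrite (npart_sg mM mN aP aQ) sg_smodal.
    by rewrite (npart_sg mM mN aP aQ) (apart_sg mM mN aP aQ).
  + move=> A M N P Q K mM mN aP aQ _ /=; rewrite !sg_r (der_blk _ _ _ _ aP aQ) => H.
    apply: (@der_jump _ (F (Box A)) (F A) _ _ erefl).
      by rewrite (npart_sg mM mN aP aQ) sg_smodal.
    by rewrite (npart_sg mM mN aP aQ) (apart_sg mM mN aP aQ).
  + move=> M N P Q P2 Q2 K mM mN aP aQ aP2 aQ2 _ _ /=.
    rewrite (der_blk _ _ _ _ aP aQ) (der_blk _ _ _ _ aP2 aQ2) => H.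
    apply: der_open; first by rewrite (npart_sg mM mN aP aQ) sg_smodal.
    rewrite (npart_sg mM mN aP aQ) (apart_sg mM mN aP aQ) /apart.
    by rewrite (mfilter_id (sg_satom aP2 aQ2)) -sg_split.
  + move=> M N P Q P2 Q2 K mM mN aP aQ aP2 aQ2 _ _ /=.
    rewrite (der_blk _ _ _ _ aP aQ) (der_blk _ _ _ _ aP2 aQ2) => H.
    apply: der_open; first by rewrite (npart_sg mM mN aP aQ) sg_smodal.
    rewrite (npart_sg mM mN aP aQ) (apart_sg mM mN aP aQ) /apart.
    by rewrite (mfilter_id (sg_satom aP2 aQ2)) -sg_split.
- move=> h1 h2 _ _ _ [] A B G K D _ /= H1 _ H2.
  + rewrite !sg_l in H1 H2 *.
    apply: (@der_local _ (T (Or A B)) [:: [mset T A]; [mset T B]]) => // p.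
    by rewrite !inE => /orP[] /eqP->; [apply: der_le H1; apply: leq_maxl|apply: der_le H2; apply: leq_maxr].
  + rewrite !sg_r in H1 H2 *.
    apply: (@der_local _ (F (And A B)) [:: [mset F A]; [mset F B]]) => // p.
    by rewrite !inE => /orP[] /eqP->; [apply: der_le H1; apply: leq_maxl|apply: der_le H2; apply: leq_maxr].
  + rewrite !sg_l in H2 *; rewrite sg_r in H1.
    apply: (@der_local _ (T (Imp A B)) [:: [mset F A]; [mset T B]]) => // p.
    by rewrite !inE => /orP[] /eqP->; [apply: der_le H1; apply: leq_maxl|apply: der_le H2; apply: leq_maxr].
Qed.

(** * From worlds of signed formulas back to marked sequents *)

Definition side c S : {mset form} := seq_mset [seq x.2 | x <- S & x.1 == c].

Lemma sideE c S A : side c S A = S (c, A).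
Proof.
rewrite /side mset_seqE count_map count_filter -count_mem_mset.
by apply: eq_count => -[d B]; rewrite /= xpair_eqE andbC.
Qed.

Lemma side_sg c G D : side c (sg G D) = if c then G else D.
Proof. by apply/msetP => A; rewrite sideE sgE; case: c. Qed.

Lemma sideD c S S' : side c (S `+` S') = side c S `+` side c S'.
Proof. by apply/msetP => A; rewrite msetE2 !sideE msetE2. Qed.

Lemma side1 c a : side c [mset a] = if a.1 == c then [mset a.2] else mset0.
Proof.
case: a => d B /=; apply/msetP => A; rewrite sideE msetnE xpair_eqE.
by rewrite (fun_if (fun X : {mset form} => X A)) msetnE mset0E eq_sym; case: (d == c).
Qed.

Lemma in_side c S A : (A \in side c S) = ((c, A) \in S).
Proof. by rewrite !in_mset sideE. Qed.

Lemma all_side (P : pred form) c S : all (fun x => P x.2) S -> all P (side c S).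
Proof. by move=> /allP PS; apply/allP => A; rewrite in_side => /PS. Qed.

Lemma satom_apart S : all satom (apart S).
Proof. by apply/allP => x; rewrite in_apart => /andP[]. Qed.

Lemma sg_side S : sg (side true S) (side false S) = S.
Proof. by apply/msetP => [[[] A]]; rewrite sgE /= sideE. Qed.

Definition seqt S (K : {mset block}) := Sequent (side true S) K (side false S).

Lemma ple_rule1 n s1 s : rule1 s1 s -> provable_le n s1 -> provable_le n.+1 s.
Proof. by move=> r [h le_h d]; exists h.+1 => //; apply: deriv_rule1 r d. Qed.

Lemma ple_rule2 n s1 s2 s : rule2 s1 s2 s ->
  provable_le n s1 -> provable_le n s2 -> provable_le n.+1 s.
Proof.
move=> r [h1 le1 d1] [h2 le2 d2]; exists (maxn h1 h2).+1; last exact: deriv_rule2 r d1 d2.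
by rewrite ltnS geq_max le1.
Qed.

(** The induction covers every marked [K] with the given contents, so a newly created block can
    receive the mark that the applied rule prescribes. *)
Lemma ple_der n S (K : {mset block}) : der n S (contents K) -> provable_le n (seqt S K).
Proof.
elim/ltn_ind: n S K => n IH S K; move EK: (contents K) => L H.
case: H IH EK => {n S L}.
- move=> n p S L ap Hl Hr _ _; exists 0 => //; apply: deriv_axiom.
  case: (mset1D_mem Hl) => R E; move: Hr; rewrite /seqt E in_mset1D /= => Hr.
  case: (mset1D_mem Hr) => R' ->; rewrite !sideD !side1 /= !mset0D.
  exact: Ax_id.
- move=> n S L Hb _ _; exists 0 => //; apply: deriv_axiom.
  case: (mset1D_mem Hb) => R ->; rewrite /seqt !sideD !side1 /= !mset0D.
  exact: Ax_bot.
- move=> n a ps S L Ha D IH EK.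
  have {}D p : p \in ps -> provable_le n (seqt (p `+` S) K).
    by move=> pps; apply: (IH n (ltnSn n)); rewrite EK; apply: D.
  (* There are one or two premises, so the first and the last exhaust the list. *)
  case: a Ha => [[] [|m|A|A B|A B|A B|A|A]]; try discriminate; case=> E; subst ps;
    have {}D := (D _ (mem_head _ _), D _ (mem_last _ _)); move: D;
    rewrite /seqt !sideD !side1 /= -?msetDA ?mset0D => -[D1 D2].
  + exact: (ple_rule1 (R_negL _ _ _ _) D1).
  + exact: (ple_rule1 (R_andL _ _ _ _ _) D1).
  + exact: (ple_rule2 (R_orL _ _ _ _ _) D1 D2).
  + exact: (ple_rule2 (R_impL _ _ _ _ _) D1 D2).
  + exact: (ple_rule1 (R_boxL _ _ _ _) D1).
  + exact: (ple_rule1 (R_negR _ _ _ _) D1).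
  + exact: (ple_rule2 (R_andR _ _ _ _ _) D1 D2).
  + exact: (ple_rule1 (R_orR _ _ _ _ _) D1).
  + exact: (ple_rule1 (R_impR _ _ _ _ _) D1).
  + exact: (ple_rule1 (R_diaR _ _ _ _) D1).
- move=> n a b S L Ha mS D IH EK.
  have mM c : all modal (side c (npart S)) by apply: all_side.
  have aP c : all atomic (side c (apart S)) by apply: all_side; apply: satom_apart.
  have {}D m : provable_le n (seqt (b +` npart S) (blk m (side true (apart S)) (side false (apart S)) `+` K)).
    by apply: (IH n (ltnSn n)); rewrite (der_blk _ _ _ _ (aP _) (aP _)) sg_side EK.
  case: a Ha => [[] [|m|A|A B|A B|A B|A|A]]; try discriminate; case=> E; subst b; rewrite -{1}(partE S).
  + move: (D BoxMark); rewrite /seqt !sideD !side1 /= ?mset0D => D1.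
    apply: ple_rule1 D1; rewrite [side false (npart S) `+` _]msetDC; exact: R_diaL.
  + move: (D DiaMark); rewrite /seqt !sideD !side1 /= ?mset0D => D1.
    apply: ple_rule1 D1; rewrite [side false (npart S) `+` _]msetDC; exact: R_boxR.
- move=> n S P L mS D IH EK.
  have : P \in contents K by rewrite EK mset1D1.
  case/contentsP => d /mset1D_mem[K' ?] EP; subst K.
  have EL : L = contents K'.
    by move: EK; rewrite contentsD contents1 -EP => /mset1D_inj.
  subst L P; rewrite blkE.
  case: d D {EK} => -[[m P] Q] /= bPQ; rewrite /content /= => D.
  (* The opened world comes from an actual block, hence is atomic and nonempty as the marked rule
     demands. *)
  have /and3P[aP' aQ' ne] := bPQ.
  have mM c : all modal (side c (npart S)) by apply: all_side.
  have aP c : all atomic (side c (apart S)) by apply: all_side; apply: satom_apart.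
  have {}D m' : provable_le n (seqt (npart S `+` sg P Q) (blk m' (side true (apart S)) (side false (apart S)) `+` K')).
    apply: (IH n (ltnSn n)); rewrite (der_blk _ _ _ _ (aP _) (aP _)) sg_side.
    by move: D; rewrite /apart (mfilter_id (sg_satom aP' aQ')).
  rewrite -{1}(partE S).
  (* The mark of the opened block selects the rule; the block left behind gets the opposite mark. *)
  case: m {bPQ}.
  + move: (D BoxMark); rewrite /seqt !sideD !side_sg [side false (npart S) `+` _]msetDC => D1.
    apply: ple_rule1 D1; rewrite [side false (npart S) `+` _]msetDC; exact: R_diaL_mid.
  + move: (D DiaMark); rewrite /seqt !sideD !side_sg [side false (npart S) `+` _]msetDC => D1.
    apply: ple_rule1 D1; rewrite [side false (npart S) `+` _]msetDC; exact: R_boxR_mid.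
Qed.

Lemma provable_leE n G (K : {mset block}) D : provable_le n (Sequent G K D) <-> der n (sg G D) (contents K).
Proof.
split=> [[h le_h /der_ple d]|/ple_der]; first exact: der_le le_h d.
by rewrite /seqt !side_sg.
Qed.

Lemma provableE G (K : {mset block}) D : provable (Sequent G K D) <-> pder (sg G D) (contents K).
Proof.
split=> [[h /der_ple d]|[n /ple_der[h _]]]; first by exists h.
by rewrite /seqt !side_sg; exists h.
Qed.

(** * The contraction rules of the marked calculus *)

(** Sending the block to the larger one is a map of worlds as in [der_mono]. Contraction inside a
    block is the case where the sets of atoms do not change. *)
Lemma provable_le_blk_sub n m (G D P P' Q Q' : {mset form}) (K : {mset block}) :
  all atomic P -> all atomic Q -> all atomic P' -> all atomic Q' ->
  {subset P <= P'} -> {subset Q <= Q'} ->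
  provable_le n (Sequent G (blk m P Q `+` K) D) ->
  provable_le n (Sequent G (blk m P' Q' `+` K) D).
Proof.
move=> aP aQ aP' aQ' sP sQ; rewrite !provable_leE.
rewrite (der_blk _ _ _ _ aP aQ) (der_blk _ _ _ _ aP' aQ') => H.
apply: (der_mono H) => // R; rewrite in_mset1D => /orP[/eqP->|RK]; right.
  exists (sg P' Q'); first by rewrite mset1D1.
  by move=> [[] A] _; rewrite !in_sg; [apply: sP | apply: sQ].
by exists R => //; rewrite in_mset1D RK orbT.
Qed.

Theorem lemma4p12 :
  (* LC; *)
  (forall (n : nat) (G D : {mset form}) (K : {mset block}) (m : mark)
          (p : form) (P0 Q0 : {mset form}),
     atomic p -> all atomic P0 -> all atomic Q0 ->
     provable_le n (Sequent G (blk m (p +` (p +` P0)) Q0 `+` K) D) ->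
     provable_le n (Sequent G (blk m (p +` P0) Q0 `+` K) D))
  /\
  (* RC; *)
  (forall (n : nat) (G D : {mset form}) (K : {mset block}) (m : mark)
          (q : form) (P0 Q0 : {mset form}),
     atomic q -> all atomic P0 -> all atomic Q0 ->
     provable_le n (Sequent G (blk m P0 (q +` (q +` Q0)) `+` K) D) ->
     provable_le n (Sequent G (blk m P0 (q +` Q0) `+` K) D))
  /\
  (* LC *)
  (forall (A : form) (G D : {mset form}) (K : {mset block}),
     provable (Sequent (A +` (A +` G)) K D) ->
     provable (Sequent (A +` G) K D))
  /\
  (* RC *)
  (forall (A : form) (G D : {mset form}) (K : {mset block}),
     provable (Sequent G K (A +` (A +` D))) ->
     provable (Sequent G K (A +` D))).
Proof.
split; [|split; [|split]].
- move=> n G D K m p P0 Q0 ap aP aQ; apply: provable_le_blk_sub; rewrite ?all_mset1D ?ap //.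
  by move=> A; rewrite !in_mset1D orbA orbb.
- move=> n G D K m q P0 Q0 aq aP aQ; apply: provable_le_blk_sub; rewrite ?all_mset1D ?aq //.
  by move=> A; rewrite !in_mset1D orbA orbb.
- by move=> A G D K; rewrite !provableE !sg_l; apply: contract.
- by move=> A G D K; rewrite !provableE !sg_r; apply: contract.
Qed.
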